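(* Any CSS state on $n$ qubits can be expressed uniquely in ZX calculus, as a diagram in encoder-respecting form, under the following rules. (Bipartite rule) The nodes can be split into two groups, one with $X$ nodes and the other with $Z$ nodes. The only interior edges allowed are between nodes of different groups. (Hadamard rule) Each $X$ node can only connect to higher-numbered $Z$ nodes. (Phase-free rule) All output nodes have phase $0$, and there are no local operations on any free edges.
   Context: ZX diagrams are considered ignoring normalization. A $Z$ node of phase $\alpha$ with $a$ inputs and $b$ outputs is the tensor $|0\rangle^{\otimes b}\langle 0|^{\otimes a}+e^{i\alpha}|1\rangle^{\otimes b}\langle 1|^{\otimes a}$. An $X$ node of phase $\beta$ is $|+\rangle^{\otimes b}\langle +|^{\otimes a}+e^{i\beta}|-\rangle^{\otimes b}\langle -|^{\otimes a}$. An edge joining two nodes is a contraction of the corresponding indices. Encoder-respecting form, for a diagram with no inputs: every node is a $Z$ or $X$ node corresponding to an output and having its own free output edge, and the $n$ output nodes are numbered $1,\dots,n$. Interior edges are the edges between nodes; here they are simple edges without Hadamard gates. The Pauli operators on $n$ qubits are $n$-fold tensor products of the Pauli matrices $I,X,Y,Z$, multiplied by a factor $i^m$ with $m\in\{0,1,2,3\}$. A stabilizer (Clifford) code is determined by its group of commuting stabilizers, which are Pauli operators; its codespace is the intersection of their $+1$ eigenspaces, and a code with $k$ inputs and $n$ outputs has $n-k$ independent stabilizer generators. A CSS code is such a code whose stabilizer generators can be chosen so that each is either a Pauli operator with only $I$ and $Z$ gates or a Pauli operator with only $I$ and $X$ gates. A CSS state is a CSS code with $0$ inputs.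
   Formalization: The stabilizer generators of the CSS state are required to be tensor products of I and Z, or of I and X, with no factor i^m (no sign); with signs the claim fails, e.g. -Z on one qubit stabilizes |1>, which no phase-free diagram expresses. *)

(* Defs.v *)
From HB Require Import structures.
From mathcomp Require Import all_boot all_order all_algebra all_fingroup.
From mathcomp Require Import ring.
From mathcomp Require Import reals trigo.
From mathcomp.real_closed Require Import complex.

Set Implicit Arguments.
Unset Strict Implicit.
Unset Printing Implicit Defensive.

Import Order.TTheory GRing.Theory Num.Theory.

Local Open Scope ring_scope.

(** * States and local operators on n qubits *)

(* Computational basis labels of n qubits. *)
Notation qbasis n := {ffun 'I_n -> 'I_2}.

(* A (not necessarily normalized) state is its family of amplitudes. *)
Notation qstate R n := {ffun qbasis n -> R[i]%C}.

(* The tensor product A_0 (x) ... (x) A_(n-1) applied to psi. *)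
Definition tensor_op (R : realType) (n : nat) (A : 'I_n -> 'M[R[i]%C]_2)
    (psi : qstate R n) : qstate R n :=
  [ffun x : qbasis n =>
     \sum_(y : qbasis n) (\prod_(j < n) A j (x j) (y j)) * psi y].

(** * The Pauli group *)

Inductive pauli := PauliI | PauliX | PauliY | PauliZ.

Definition pauli_code (p : pauli) : bool * bool :=
  match p with
  | PauliI => (false, false) | PauliX => (true, false)
  | PauliY => (true, true)   | PauliZ => (false, true)
  end.

Definition pauli_decode (c : bool * bool) : pauli :=
  match c with
  | (false, false) => PauliI | (true, false) => PauliX
  | (true, true) => PauliY   | (false, true) => PauliZ
  end.

Lemma pauli_codeK : cancel pauli_code pauli_decode.
Proof. by case. Qed.

HB.instance Definition _ := Finite.copy pauli (can_type pauli_codeK).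

Definition mx22 (K : pzRingType) (a b c d : K) : 'M[K]_2 :=
  \matrix_(i, j) if i == 0 then (if j == 0 then a else b)
                 else (if j == 0 then c else d).

Definition pauli_mx (R : realType) (p : pauli) : 'M[R[i]%C]_2 :=
  match p with
  | PauliI => 1%:M
  | PauliX => mx22 0 1 1 0
  | PauliY => mx22 0 (- 'i) 'i 0
  | PauliZ => mx22 1 0 0 (- 1)
  end.

(* The product of two Pauli matrices is pauli_mul up to the power of i with
   exponent pauli_cocycle; see pauli_mxM. *)
Definition pauli_mul (p q : pauli) : pauli :=
  pauli_decode ((pauli_code p).1 (+) (pauli_code q).1,
                (pauli_code p).2 (+) (pauli_code q).2).

Definition pauli_cocycle (p q : pauli) : 'Z_4 :=
  match p, q with
  | PauliX, PauliY | PauliY, PauliZ | PauliZ, PauliX => 1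
  | PauliY, PauliX | PauliZ, PauliY | PauliX, PauliZ => - 1
  | _, _ => 0
  end.

(* PauliOp m P stands for i^m P_0 (x) ... (x) P_(n-1); see pauli_act. *)
Record pauli_op (n : nat) := PauliOp {
  pauli_phase : 'Z_4;
  pauli_gates : {ffun 'I_n -> pauli}
}.

Definition pauli_op_pair n (P : pauli_op n) := (pauli_phase P, pauli_gates P).
Definition pair_pauli_op n (u : 'Z_4 * {ffun 'I_n -> pauli}) :=
  PauliOp u.1 u.2.

Lemma pauli_op_pairK n : cancel (@pauli_op_pair n) (@pair_pauli_op n).
Proof. by case. Qed.

HB.instance Definition _ n :=
  Finite.copy (pauli_op n) (can_type (@pauli_op_pairK n)).

Section PauliGroup.

Variable n : nat.
Implicit Types P Q : pauli_op n.

Definition pauli_op_mul P Q : pauli_op n :=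
  PauliOp
    (pauli_phase P + pauli_phase Q
     + \sum_(j < n) pauli_cocycle (pauli_gates P j) (pauli_gates Q j))
    [ffun j => pauli_mul (pauli_gates P j) (pauli_gates Q j)].

Definition pauli_op_one : pauli_op n := PauliOp 0 [ffun=> PauliI].

Definition pauli_op_inv P : pauli_op n :=
  PauliOp (- pauli_phase P) (pauli_gates P).

Lemma pauli_mulA : associative pauli_mul.
Proof. by do 3!case. Qed.

Lemma pauli_cocycleP p q r :
  pauli_cocycle q r + pauli_cocycle p (pauli_mul q r)
  = pauli_cocycle p q + pauli_cocycle (pauli_mul p q) r.
Proof. by case: p; case: q; case: r; apply/val_inj. Qed.

Lemma pauli_op_mulA : associative pauli_op_mul.
Proof.
move=> P Q T; rewrite /pauli_op_mul /=; congr PauliOp; last first.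
  by apply/ffunP => j; rewrite !ffunE pauli_mulA.
rewrite -!addrA; congr (_ + (_ + _)).
rewrite [RHS]addrCA; congr (_ + _).
rewrite -!big_split /=; apply: eq_bigr => j _.
by rewrite !ffunE pauli_cocycleP.
Qed.

Lemma pauli_op_mul1 : left_id pauli_op_one pauli_op_mul.
Proof.
move=> [m P]; rewrite /pauli_op_mul /=; congr PauliOp.
  by rewrite add0r big1 ?addr0 // => j _; rewrite ffunE; case: (P j).
by apply/ffunP => j; rewrite !ffunE; case: (P j).
Qed.

Lemma pauli_op_mulV : left_inverse pauli_op_one pauli_op_inv pauli_op_mul.
Proof.
move=> [m P]; rewrite /pauli_op_mul /pauli_op_one /=; congr PauliOp.
  by rewrite addNr add0r big1 // => j _; case: (P j).
by apply/ffunP => j; rewrite !ffunE; case: (P j).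
Qed.

HB.instance Definition _ := Finite_isGroup.Build (pauli_op n)
  pauli_op_mulA pauli_op_mul1 pauli_op_mulV.

End PauliGroup.

Definition pauli_act (R : realType) (n : nat) (P : pauli_op n)
    (psi : qstate R n) : qstate R n :=
  [ffun x => 'i ^+ pauli_phase P
             * tensor_op (fun j => pauli_mx R (pauli_gates P j)) psi x].

Section PauliAction.

Variables (R : realType) (n : nat).
Implicit Types (P Q : pauli_op n) (psi : qstate R n).

Lemma expiD (a b : 'Z_4) :
  'i ^+ (a + b : 'Z_4)%R = 'i ^+ a * 'i ^+ b :> R[i]%C.
Proof.
have i4 : 'i ^+ 4 = 1 :> R[i]%C by rewrite (exprM _ 2 2) sqrCi sqrrN expr1n.
by rewrite -exprD /= expr_mod.
Qed.

Lemma pauli_mxM (p q : pauli) :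
  pauli_mx R p *m pauli_mx R q
  = 'i ^+ pauli_cocycle p q *: pauli_mx R (pauli_mul p q).
Proof.
have ii : 'i * 'i = - 1 :> R[i]%C by rewrite -expr2 sqrCi.
have i3 : 'i ^+ 3 = - 'i :> R[i]%C by rewrite exprS sqrCi mulrN1.
case: p; case: q; rewrite /= ?mul1mx ?mulmx1 ?expr0 ?scale1r //;
  apply/matrixP; case; case=> [|[|//]] ?; case; case=> [|[|//]] ?;
  by rewrite !mxE !big_ord_recl big_ord0 !mxE /= ?(expr0, expr1, i3)
    ?(mulr0, mul0r, addr0, add0r, mulr1, mul1r, mulrN, mulNr, opprK, ii).
Qed.

Lemma tensor_op1 (A : 'I_n -> 'M[R[i]%C]_2) psi :
  (forall j, A j = 1%:M) -> tensor_op A psi = psi.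
Proof.
move=> A1; apply/ffunP => x; rewrite ffunE (bigD1 x) //= big1 => [|j _].
  rewrite mul1r big1 ?addr0 // => y nyx.
  suff -> : \prod_(j < n) A j (x j) (y j) = 0 by rewrite mul0r.
  apply/eqP; apply: contraNT nyx => /prodf_neq0 h; apply/eqP/ffunP => j.
  by have := h j isT; rewrite A1 mxE; case: (x j =P y j) => [->|_] //; rewrite mulr0n eqxx.
by rewrite A1 mxE eqxx.
Qed.

Lemma tensor_opM (A B : 'I_n -> 'M[R[i]%C]_2) psi :
  tensor_op A (tensor_op B psi) = tensor_op (fun j => A j *m B j) psi.
Proof.
apply/ffunP => x; rewrite !ffunE.
under eq_bigr => y _ do rewrite ffunE mulr_sumr.
rewrite exchange_big /=; apply: eq_bigr => z _.
under eq_bigr => y _ do rewrite mulrA -big_split /=.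
rewrite -mulr_suml; congr (_ * _).
under [RHS]eq_bigr => j _ do rewrite mxE.
by rewrite bigA_distr_bigA.
Qed.

Lemma tensor_opZ (A : 'I_n -> 'M[R[i]%C]_2) (a : 'I_n -> R[i]%C) psi x :
  tensor_op (fun j => a j *: A j) psi x = (\prod_j a j) * tensor_op A psi x.
Proof.
rewrite !ffunE mulr_sumr; apply: eq_bigr => y _; rewrite mulrA -big_split /=.
by under eq_bigr => j _ do rewrite mxE.
Qed.

Lemma pauli_act1 psi : pauli_act 1%g psi = psi.
Proof.
apply/ffunP => x; rewrite ffunE /= expr0 mul1r tensor_op1 // => j.
by rewrite ffunE.
Qed.

Lemma pauli_actM P Q psi :
  pauli_act (P * Q)%g psi = pauli_act P (pauli_act Q psi).
Proof.
apply/ffunP => x; rewrite ffunE [RHS]ffunE.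
have -> : pauli_act Q psi = tensor_op (fun j => pauli_mx R (pauli_gates Q j))
                              [ffun y => 'i ^+ pauli_phase Q * psi y].
  apply/ffunP => y; rewrite !ffunE mulr_sumr; apply: eq_bigr => z _.
  by rewrite ffunE mulrCA.
rewrite tensor_opM.
have -> (c : R[i]%C) (A : 'I_n -> 'M[R[i]%C]_2) :
    tensor_op A [ffun y => c * psi y] x = c * tensor_op A psi x.
  by rewrite !ffunE mulr_sumr; apply: eq_bigr => z _; rewrite ffunE mulrCA.
have -> : tensor_op (fun j => pauli_mx R (pauli_gates P j)
                              *m pauli_mx R (pauli_gates Q j)) psi x
  = tensor_op (fun j => 'i ^+ pauli_cocycle (pauli_gates P j) (pauli_gates Q j)
      *: pauli_mx R (pauli_mul (pauli_gates P j) (pauli_gates Q j))) psi x.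
  rewrite !ffunE; apply: eq_bigr => y _; congr (_ * _).
  by apply: eq_bigr => j _; rewrite pauli_mxM.
rewrite tensor_opZ !mulrA [pauli_phase (P * Q)%g]/(pauli_phase P + _ + _).
rewrite !expiD; congr (_ * _ * _); last first.
  rewrite !ffunE; apply: eq_bigr => y _; congr (_ * _).
  by apply: eq_bigr => j _; rewrite ffunE.
by elim/big_rec2: _ => [|j u v _ <-]; rewrite ?expr0 // expiD.
Qed.

End PauliAction.

(** * Stabilizer and CSS codes *)

(* - I^(x)n *)
Definition pauli_op_opp1 (n : nat) : pauli_op n := PauliOp 2 [ffun=> PauliI].

Definition independent (n r : nat) (g : 'I_r -> pauli_op n) : Prop :=
  forall j : 'I_r, g j \notin <<[set g l | l in predC1 j]>>%g.

(* The stabilizer group S of a code with k inputs and n outputs, together with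
   a choice g of n - k independent generators. Excluding - I from S is what
   makes the codespace nonzero. *)
Definition stabilizer_code_gen (n k : nat) (S : {group pauli_op n})
    (g : 'I_(n - k) -> pauli_op n) : Prop :=
  [/\ (k <= n)%N, abelian S, pauli_op_opp1 n \notin S,
      independent g & <<[set g j | j : 'I_(n - k)]>>%g = S].

(* Operators with only I and Z gates: no sign or other power of i is allowed.
   (With signs, - Z would make |1> a CSS state, and |1> is not the value of a
   phase-free diagram.) *)
Definition Z_type (n : nat) (P : pauli_op n) : Prop :=
  pauli_phase P = 0 /\
  forall j, pauli_gates P j = PauliI \/ pauli_gates P j = PauliZ.

Definition X_type (n : nat) (P : pauli_op n) : Prop :=
  pauli_phase P = 0 /\
  forall j, pauli_gates P j = PauliI \/ pauli_gates P j = PauliX.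

Definition CSS_code (n k : nat) (S : {group pauli_op n}) : Prop :=
  exists g : 'I_(n - k) -> pauli_op n,
    stabilizer_code_gen S g /\ forall j, Z_type (g j) \/ X_type (g j).

Definition CSS_state (n : nat) (S : {group pauli_op n}) : Prop :=
  CSS_code 0 S.

Definition codespace (R : realType) (n : nat) (S : {group pauli_op n})
    (psi : qstate R n) : Prop :=
  forall P, P \in S -> pauli_act P psi = psi.

(** * ZX diagrams *)

Inductive zx_kind := ZNode | XNode.

(* A diagram without inputs in encoder-respecting form: the nodes are the n
   outputs, each carrying its own free edge. Interior edges form a simple
   graph; a free edge carries either no local operation (None) or a
   single-qubit operator. *)
Record zx_diagram (R : realType) (n : nat) := ZXDiagram {
  zx_node : {ffun 'I_n -> zx_kind};
  zx_phase : {ffun 'I_n -> R};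
  zx_edges : {set {set 'I_n}};
  zx_local : {ffun 'I_n -> option 'M[R[i]%C]_2};
  zx_simple : [forall e in zx_edges, #|e| == 2%N]
}.

Section ZXSemantics.

Variable R : realType.

Definition ket0 : 'cV[R[i]%C]_2 := delta_mx 0 0.
Definition ket1 : 'cV[R[i]%C]_2 := delta_mx 1 0.
Definition ketplus : 'cV[R[i]%C]_2 := (sqrtC 2)^-1 *: (ket0 + ket1).
Definition ketminus : 'cV[R[i]%C]_2 := (sqrtC 2)^-1 *: (ket0 - ket1).

Definition expi (a : R) : R[i]%C := (cos a +i* sin a)%C.

(* The entry, at the leg values s, of the tensor
   |u>^b <u|^a + e^(i alpha) |v>^b <v|^a. The vectors u and v used below are
   real, so input and output legs contribute the same factors. *)
Definition spider (u v : 'cV[R[i]%C]_2) (alpha : R) (s : seq 'I_2) : R[i]%C :=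
  \prod_(b <- s) u b 0 + expi alpha * \prod_(b <- s) v b 0.

Definition node_tensor (k : zx_kind) : R -> seq 'I_2 -> R[i]%C :=
  match k with
  | ZNode => spider ket0 ket1
  | XNode => spider ketplus ketminus
  end.

Variable n : nat.
Implicit Type D : zx_diagram R n.

Notation interior_edge D := {e : {set 'I_n} | e \in zx_edges D}.

(* The values on the legs of node j: its free edge, then its interior edges. *)
Definition legs D (y : qbasis n) (f : {ffun interior_edge D -> 'I_2})
    (j : 'I_n) : seq 'I_2 :=
  y j :: [seq f e | e in [pred e : interior_edge D | j \in sval e]].

(* Contraction of all interior edges. *)
Definition zx_contract D : qstate R n :=
  [ffun y => \sum_(f : {ffun interior_edge D -> 'I_2})
               \prod_(j < n)
                 node_tensor (zx_node D j) (zx_phase D j) (legs y f j)].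

Definition zx_state D : qstate R n :=
  tensor_op (fun j => odflt 1%:M (zx_local D j)) (zx_contract D).

(* D expresses the state with stabilizer group S, ignoring normalization: the
   codespace is the line spanned by the value of D. *)
Definition expresses D (S : {group pauli_op n}) : Prop :=
  zx_state D != 0 /\
  forall psi : qstate R n,
    codespace S psi <->
    exists c : R[i]%C, psi = [ffun x => c * zx_state D x].

Definition bipartite_rule D : Prop :=
  forall i j, [set i; j] \in zx_edges D -> zx_node D i <> zx_node D j.

Definition hadamard_rule D : Prop :=
  forall i j, [set i; j] \in zx_edges D -> zx_node D i = XNode ->
    zx_node D j = ZNode /\ (i < j)%N.

Definition phase_free_rule D : Prop :=
  forall j, zx_phase D j = 0 /\ zx_local D j = None.

End ZXSemantics.

(* Main.v *)
(* The Z-type generators confine the states of the codespace to the kernel V of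
   a binary matrix, and the X-type generators make them invariant under
   translations by a subspace W. Commutation gives W <= V, and counting the n
   independent generators gives dim W >= dim V; hence the codespace is the line
   spanned by the indicator function of V.
   In a diagram obeying the rules, the Z spiders copy the values of the Z
   outputs along the edges and each X spider is a parity check, so its value is
   a multiple of the indicator function of the solutions of
   y_i = sum of the y_j over the neighbours j of i, one equation per X node i.
   As i < j for all these j, this is the reduced echelon form of a system of
   equations, which exists and is unique for every subspace of F_2^n. *)

Require Import Defs.
From mathcomp Require Import all_boot all_order all_algebra all_fingroup.
From mathcomp Require Import ring reals trigo.
From mathcomp.real_closed Require Import complex.

Set Implicit Arguments.
Unset Strict Implicit.
Unset Printing Implicit Defensive.

Import Order.TTheory GRing.Theory Num.Theory.

Local Open Scope ring_scope.

(** * Arithmetic and signs over the field with two elements *)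

Lemma F2P (a : 'F_2) : a = 0 \/ a = 1.
Proof. by case: a => [[|[|//]] ?]; [left|right]; apply/val_inj. Qed.

Lemma F2_neq0 (a : 'F_2) : (a != 0) = (a == 1).
Proof. by case: (F2P a) => ->. Qed.

Lemma oppr_F2 (a : 'F_2) : - a = a.
Proof. by case: (F2P a) => ->; apply/val_inj. Qed.

Lemma oppmx_F2 m n (A : 'M['F_2]_(m, n)) : - A = A.
Proof. by apply/matrixP => i j; rewrite mxE oppr_F2. Qed.

(** The sum on the left is reduced modulo 2 before it becomes an exponent; a power of -1 sees only
    the parity. *)
Lemma signr_F2D (K : pzRingType) (a b : 'F_2) :
  (-1) ^+ (a + b)%R = (-1) ^+ a * (-1) ^+ b :> K.
Proof.
by rewrite -exprD -[LHS]signr_odd -[RHS]signr_odd -!modn2 /= modn_mod.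
Qed.

Lemma signr_F2_sum (K : comPzRingType) (I : Type) (r : seq I) (P : pred I)
    (a : I -> 'F_2) :
  \prod_(i <- r | P i) (-1) ^+ a i = (-1) ^+ (\sum_(i <- r | P i) a i)%R :> K.
Proof. by elim/big_rec2: _ => [//|i x _ _ ->]; rewrite signr_F2D. Qed.

(** * Reduced echelon form with pivots at last nonzero entries *)

Section EchelonForm.

Variables (F : finFieldType) (m n : nat) (A : 'M[F]_(m, n)).

(* The last nonzero entry, not the first, is the pivot: an X node is
   determined by Z nodes with higher numbers. *)
Definition pivot (j : 'I_n) : bool :=
  [exists b : 'rV[F]_n, [&& (b <= A)%MS, b 0 j != 0 &
    [forall k : 'I_n, (j < k)%N ==> (b 0 k == 0)]]].

Lemma pivotP (j : 'I_n) :
  reflect (exists b : 'rV[F]_n,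
    [/\ (b <= A)%MS, b 0 j != 0 & forall k : 'I_n, (j < k)%N -> b 0 k = 0])
    (pivot j).
Proof.
apply: (iffP existsP) => -[b].
  by case/and3P=> bA bj /forall_inP bk; exists b; split=> // k /bk/eqP.
case=> bA bj bk; exists b; rewrite bA bj /=.
by apply/forall_inP => k /bk ->.
Qed.

(** A nonzero [v] would witness by itself that the position of its last nonzero entry is a pivot. *)
Lemma pivot_eq0 (v : 'rV[F]_n) :
  (v <= A)%MS -> (forall j, pivot j -> v 0 j = 0) -> v = 0.
Proof.
move=> vA v0; apply/eqP/contraT => /rV0Pn[i0 vi0].
case: (@arg_maxnP _ i0 (fun i => v 0 i != 0) (@nat_of_ord n) vi0) => j vj jmax.
suff pj : pivot j by rewrite v0 ?eqxx in vj.
apply/pivotP; exists v; split=> // k jk.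
by apply/eqP/contraT => /jmax /=; rewrite leqNgt jk.
Qed.

(** Elimination from the right, by induction on [l]: if position [l] is a pivot, a multiple of its
    witness [b] clears [p] there, and it is added back to the vector found for the rest. As [b]
    vanishes beyond [l], the support bound survives. *)
Lemma pivot_interpolation (l : nat) (p : 'rV[F]_n) :
  (forall k : 'I_n, (l <= k)%N -> pivot k -> p 0 k = 0) ->
  exists y : 'rV[F]_n, [/\ (y <= A)%MS, forall k, pivot k -> y 0 k = p 0 k
    & forall k : 'I_n, (l <= k)%N -> y 0 k = 0].
Proof.
elim: l p => [|l IHl] p p0.
  exists 0; split=> [|k kA|k _]; rewrite ?sub0mx ?mxE //.
  by rewrite p0.
have [ln|nl] := ltnP l n; last first.
  have [k lk|y [yA yp y0]] := IHl p; last by exists y; split=> // k /ltnW/y0.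
  by have := leq_ltn_trans lk (ltn_ord k); rewrite ltnNge nl.
pose o := Ordinal ln.
have eqo (k : 'I_n) : (l <= k)%N -> k = o \/ (l < k)%N.
  by rewrite leq_eqVlt => /orP[/eqP lk|->]; [left; apply/val_inj|right].
have [/pivotP[b [bA bo bk]]|oA] := boolP (pivot o); last first.
  have [|y [yA yp y0]] := IHl p.
    by move=> k /eqo[->|/p0//]; rewrite (negPf oA).
  by exists y; split=> // k /ltnW/y0.
pose c := p 0 o / b 0 o.
have [|y [yA yp y0]] := IHl (p - c *: b).
  move=> k /eqo[->|lk] kA; rewrite !mxE ?divfK ?subrr //.
  by rewrite p0 // bk // mulr0 subrr.
exists (y + c *: b); split=> [|k kA|k lk].
- by rewrite addmx_sub ?scalemx_sub.
- by rewrite mxE yp // !mxE subrK.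
- by rewrite !mxE y0 ?(ltnW lk) // bk // mulr0 addr0.
Qed.

Lemma pivot_basis : exists B : 'I_n -> 'rV[F]_n, forall j, pivot j ->
  [/\ (B j <= A)%MS, forall k, pivot k -> B j 0 k = (k == j)%:R
    & forall k : 'I_n, (j < k)%N -> B j 0 k = 0].
Proof.
apply: (fin_all_exists (P := fun j (b : 'rV[F]_n) => pivot j ->
  [/\ (b <= A)%MS, forall k, pivot k -> b 0 k = (k == j)%:R
    & forall k : 'I_n, (j < k)%N -> b 0 k = 0])) => j.
(* The bound [j.+1] leaves entry [j] free and forces zeros strictly after it. *)
have [|y [yA yp y0]] := @pivot_interpolation j.+1 (delta_mx 0 j).
  by move=> k jk _; rewrite mxE /= -val_eqE gtn_eqF.
by exists y => _; split=> // k /yp ->; rewrite mxE.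
Qed.

(** For [v] in the row space, the difference of the two sides lies in it too and vanishes at every
    pivot, so [pivot_eq0] applies. *)
Lemma sub_pivot_basis (B : 'I_n -> 'rV[F]_n) (v : 'rV[F]_n) :
  (forall j, pivot j -> (B j <= A)%MS /\
     forall k, pivot k -> B j 0 k = (k == j)%:R) ->
  (v <= A)%MS = (v == \sum_(j | pivot j) v 0 j *: B j).
Proof.
move=> BA; set w := \sum_(j | _) _.
have wA : (w <= A)%MS.
  by apply: summx_sub => j /BA[] BjA _; apply: scalemx_sub.
apply/idP/eqP => [vA|->//].
apply/eqP; rewrite -subr_eq0; apply/eqP/pivot_eq0 => [|k kA].
  by rewrite addmx_sub // eqmx_opp.
rewrite !mxE summxE (bigD1 k) //= big1 => [|j /andP[/BA[_ Bj] jk]].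
  by rewrite mxE; have [_ ->] := BA k kA; rewrite // eqxx mulr1 addr0 subrr.
by rewrite mxE Bj // eq_sym (negPf jk) mulr0.
Qed.

End EchelonForm.

(** * CSS stabilizer groups and their codespaces *)

Section States.

Variables (R : realType) (n : nat).
Local Notation C := R[i]%C.
Implicit Types (v w : 'rV['F_2]_n) (x y : qbasis n) (psi : qstate R n).

Definition basis_vec x : 'rV['F_2]_n := \row_j x j.
Definition vec_basis v : qbasis n := [ffun j => v 0 j].

Lemma basis_vecK : cancel basis_vec vec_basis.
Proof. by move=> x; apply/ffunP => j; rewrite ffunE mxE. Qed.

Lemma vec_basisK : cancel vec_basis basis_vec.
Proof. by move=> v; apply/rowP => j; rewrite mxE ffunE. Qed.

(** Each row of [A j] has at most one nonzero entry, in the column given by [s j], so the sum over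
    basis labels collapses to one term. *)
Lemma tensor_op_monomial (A : 'I_n -> 'M[C]_2) (s : 'I_n -> 'I_2 -> 'I_2)
    (d : 'I_n -> 'I_2 -> C) psi x :
  (forall j a b, A j a b = (b == s j a)%:R * d j a) ->
  tensor_op A psi x = (\prod_j d j (x j)) * psi [ffun j => s j (x j)].
Proof.
move=> AE; rewrite ffunE (bigD1 [ffun j => s j (x j)]) //=.
rewrite [X in _ + X]big1 => [|y yx].
  rewrite addr0; congr (_ * _); apply: eq_bigr => j _.
  by rewrite AE ffunE eqxx mul1r.
suff -> : \prod_(j < n) A j (x j) (y j) = 0 by rewrite mul0r.
apply/eqP; apply: contraNT yx => /prodf_neq0 h; apply/eqP/ffunP => j.
have := h j isT; rewrite AE ffunE.
by case: (y j =P _) => // _; rewrite mul0r eqxx.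
Qed.

Definition css_op (t : bool) v : pauli_op n :=
  PauliOp 0 [ffun j => if v 0 j == 0 then PauliI
                       else if t then PauliZ else PauliX].

Lemma css_opP (P : pauli_op n) :
  Z_type P \/ X_type P -> exists u : bool * 'rV['F_2]_n, P = css_op u.1 u.2.
Proof.
case: P => m P; rewrite /Z_type /X_type /=.
case=> -[-> gP]; [exists (true, \row_j (P j != PauliI)%:R)
  | exists (false, \row_j (P j != PauliI)%:R)];
  congr PauliOp; apply/ffunP => j; rewrite ffunE mxE /=;
  by case: (gP j) => ->.
Qed.

Lemma css_op0 t : css_op t 0 = 1%g.
Proof. by congr PauliOp; apply/ffunP => j; rewrite !ffunE mxE eqxx. Qed.

Lemma css_opD t v w : css_op t (v + w) = (css_op t v * css_op t w)%g.
Proof.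
transitivity (pauli_op_mul (css_op t v) (css_op t w)); last by [].
congr PauliOp => /=.
  rewrite big1 ?addr0 // => j _; rewrite !ffunE.
  by case: t; case: ifP => _; case: ifP.
apply/ffunP => j; rewrite !ffunE mxE.
by case: (F2P (v 0 j)) => ->; case: (F2P (w 0 j)) => ->; case: t.
Qed.

Lemma css_op_Z v psi x : pauli_act (css_op true v) psi x
  = (-1) ^+ (\sum_j v 0 j * x j : 'F_2)%R * psi x.
Proof.
rewrite ffunE /= expr0 mul1r.
rewrite (@tensor_op_monomial _ (fun=> id)
          (fun j a => (-1) ^+ (v 0 j * a : 'F_2)%R)).
  rewrite signr_F2_sum; congr (_ * psi _).
  by apply/ffunP => j; rewrite ffunE.
move=> j a b; rewrite ffunE.
case: (F2P (v 0 j)) => ->.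
  by rewrite mul0r eqxx mxE expr0 mulr1 eq_sym.
rewrite mul1r /= mxE.
by case: (F2P a) => ->; case: (F2P b) => -> /=;
  rewrite ?expr0 ?expr1 ?mul1r ?mul0r.
Qed.

Lemma css_op_X v psi x : pauli_act (css_op false v) psi x
  = psi (vec_basis (basis_vec x + v)).
Proof.
rewrite ffunE /= expr0 mul1r.
rewrite (@tensor_op_monomial _ (fun j a => a + v 0 j : 'F_2) (fun _ _ => 1)).
  rewrite big1 // mul1r; congr (psi _).
  by apply/ffunP => j; rewrite !ffunE !mxE.
move=> j a b; rewrite ffunE mulr1.
case: (F2P (v 0 j)) => ->; first by rewrite eqxx mxE addr0 eq_sym.
rewrite /= mxE.
by case: (F2P a) => ->; case: (F2P b) => ->.
Qed.


Lemma codespace_gen m (g : 'I_m -> pauli_op n) (S : {group pauli_op n}) psi :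
  <<[set g j | j : 'I_m]>>%g = S ->
  codespace S psi <-> forall j, pauli_act (g j) psi = psi.
Proof.
move=> gS; split=> [Spsi j|gpsi P].
  by apply: Spsi; rewrite -gS mem_gen ?imset_f.
pose T := [set P | pauli_act P psi == psi].
have gT : group_set T.
  apply/group_setP; split=> [|Q1 Q2]; rewrite !inE ?pauli_act1 //.
  by rewrite pauli_actM => /eqP P1 /eqP->; rewrite P1.
suff : <<[set g j | j : 'I_m]>>%g \subset Group gT.
  by rewrite gS => /subsetP/[apply]; rewrite inE => /eqP.
by rewrite gen_subG; apply/subsetP => _ /imsetP[j _ ->]; rewrite inE gpsi.
Qed.

(** The two orders of the product differ by the sign with exponent v.w. It becomes visible on the
    all-ones state at the label [w], which the translation by [w] sends to 0. *)
Lemma css_op_comm v w :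
  commute (css_op true v) (css_op false w) -> \sum_j v 0 j * w 0 j = 0.
Proof.
move=> vw; pose one : qstate R n := [ffun=> 1].
have: pauli_act (css_op true v * css_op false w)%g one (vec_basis w)
    = pauli_act (css_op false w * css_op true v)%g one (vec_basis w).
  by rewrite vw.
rewrite !pauli_actM css_op_Z !css_op_X css_op_Z vec_basisK.
have -> : w + w = 0 by rewrite -{1}[w]oppmx_F2 addNr.
rewrite [in LHS]ffunE [in RHS]ffunE !mulr1.
have -> : \sum_j v 0 j * (vec_basis 0 j : 'F_2) = 0.
  by rewrite big1 // => j _; rewrite ffunE mxE mulr0.
have -> : \sum_j v 0 j * (vec_basis w j : 'F_2) = \sum_j v 0 j * w 0 j.
  by apply: eq_bigr => j _; rewrite ffunE.
case: (F2P (\sum_j v 0 j * w 0 j)) => -> //= /eqP.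
by rewrite expr1 -subr_eq0 -opprD oppr_eq0 -mulr2n pnatr_eq0.
Qed.

(** The blocks separate the two types, padding with zero rows. A relation between rows that involves
    row [j] writes [V j] as a sum of other vectors of the same type, hence its operator as a product
    of other generators. *)
Lemma css_op_row_free m (t : 'I_m -> bool) (V : 'I_m -> 'rV['F_2]_n)
    (H := fun b => \matrix_(j < m) (if t j == b then V j else 0)) :
  independent (fun j => css_op (t j) (V j)) ->
  row_free (row_mx (H true) (H false)).
Proof.
move=> indep; apply/inj_row_free => u; rewrite mul_mx_row -[0]row_mx0.
case/eq_row_mx => uHt uHf; apply/eqP/contraT => /rV0Pn[j uj].
have uH b : u *m H b = 0 by case: b.
have /eqP := uH (t j); rewrite mulmx_sum_row (bigD1 j) //= addr_eq0.
move: uj; rewrite F2_neq0 => /eqP ->; rewrite scale1r rowK eqxx oppmx_F2.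
move=> /eqP Vj; have /negP[] := indep j; rewrite Vj.
set G := <<_>>%g.
apply: (big_ind (fun v => css_op (t j) v \in G)) => [|v w vG wG|l lj].
- by rewrite css_op0 group1.
- by rewrite css_opD groupM.
rewrite rowK; case: eqP => [<-|_]; last by rewrite scaler0 css_op0 group1.
case: (F2P (u 0 l)) => ->; first by rewrite scale0r css_op0 group1.
by rewrite scale1r mem_gen // (imset_f (fun l => css_op (t l) (V l))).
Qed.

Lemma CSS_state_codespace (S : {group pauli_op n}) : CSS_state S ->
  exists A : 'M['F_2]_n, forall psi, codespace S psi <->
    exists c : C, psi = [ffun x => c * (basis_vec x <= A)%MS%:R].
Proof.
case=> g0 [[_ abS _ indep0 gen0] type0].
have [g [abg indep genS type]] : exists g : 'I_n -> pauli_op n,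
    [/\ forall i j, commute (g i) (g j), independent g,
        <<[set g j | j : 'I_n]>>%g = S
      & forall j, Z_type (g j) \/ X_type (g j)].
  (* The index type ['I_(n - 0)] is rewritten to ['I_n] in the family and all its properties at
     once. *)
  move: g0 indep0 gen0 type0; rewrite subn0 => g ? gS ?.
  exists g; split=> // i j; apply: (centsP abS); rewrite -gS mem_gen //;
    exact: imset_f.
have {type} [tV gE] : exists tV : 'I_n -> bool * 'rV['F_2]_n,
    forall j, g j = css_op (tV j).1 (tV j).2.
  apply: (fin_all_exists (P := fun j u => g j = css_op u.1 u.2)) => j.
  exact: css_opP.
pose t j := (tV j).1; pose V j := (tV j).2.
pose H b := \matrix_(j < n) (if t j == b then V j else 0).
(* The [n] independent generators give the block matrix rank [n], and this rank is at most the sum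
   of the ranks of its blocks. *)
have rkH : (n <= \rank (H true) + \rank (H false))%N.
  have : row_free (row_mx (H true) (H false)).
    apply: css_op_row_free => j; have := indep j.
    by rewrite (eq_imset _ gE) gE.
  move=> /eqP {1}<-.
  have -> : row_mx (H true) (H false)
      = H true *m row_mx 1%:M 0 + H false *m row_mx 0 1%:M.
    by rewrite !mul_mx_row !mulmx0 !mulmx1 add_row_mx addr0 add0r.
  by apply: leq_trans (mxrank_add _ _) _; rewrite leq_add ?mxrankM_maxl.
have HH : H false *m (H true)^T = 0.
  apply/matrixP => i j; rewrite !mxE.
  under eq_bigr => k _ do rewrite !mxE.
  case: eqP => ti; last by rewrite big1 // => k _; rewrite mxE mul0r.
  case: eqP => tj; last by rewrite big1 // => k _; rewrite mxE mulr0.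
  under eq_bigr => k _ do rewrite mulrC.
  by apply: css_op_comm; have := abg j i; rewrite !gE -/(t i) -/(t j) ti tj.
pose A := kermx (H true)^T.
(* Commutation gives the converse inclusion; by [rkH], the kernel has dimension n - rank (H true) <=
   rank (H false), so the two spaces coincide. *)
have HA : (A <= H false)%MS.
  have HkA : (H false <= A)%MS by apply/sub_kermxP.
  rewrite -(geq_leqif (mxrank_leqif_sup HkA)) mxrank_ker mxrank_tr.
  by rewrite leq_subLR.
have memA x : (basis_vec x <= A)%MS
    = [forall j, t j ==> (\sum_k V j 0 k * x k == 0)].
  apply/sub_kermxP/forall_inP => [xA j tj|xA].
    have /rowP/(_ j) := xA; rewrite !mxE => xj; apply/eqP; rewrite -[RHS]xj.
    by apply: eq_bigr => k _; rewrite !mxE tj mulrC.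
  apply/rowP => j; rewrite !mxE.
  have [tj|tj] := boolP (t j); last first.
    by rewrite big1 // => k _; rewrite !mxE (negPf tj) mxE mulr0.
  rewrite -[RHS](eqP (xA j tj)); apply: eq_bigr => k _.
  by rewrite !mxE tj mulrC.
exists A => psi; rewrite (codespace_gen psi genS); split=> [gpsi|[c ->] j].
  (* The amplitude at 0 determines the state: a label in [A] is reached from 0 by translations along
     X-type generators, each of which preserves amplitudes. *)
  exists (psi (vec_basis 0)); apply/ffunP => x; rewrite ffunE.
  have [xA|] := boolP (basis_vec x <= A)%MS.
    have /submxP[u xE] := submx_trans xA HA.
    rewrite mulr1 -[x in LHS]basis_vecK xE mulmx_sum_row.
    elim/big_rec: _ => //= j v _ <-.
    case: (F2P (u 0 j)) => ->; first by rewrite scale0r add0r.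
    rewrite scale1r rowK; case: eqP => tj; last by rewrite add0r.
    rewrite addrC -{1}[v]vec_basisK -css_op_X.
    by rewrite -[in RHS](gpsi j) gE -/(t j) tj.
  (* Outside [A] some Z-type check is violated; its generator gives psi x = - psi x. *)
  rewrite memA negb_forall => /existsP[j]; rewrite negb_imply mulr0.
  case/andP=> tj xj.
  have /ffunP/(_ x) := gpsi j; rewrite gE -/(t j) tj css_op_Z.
  move: xj; rewrite F2_neq0 => /eqP ->; rewrite expr1 mulN1r => /eqP.
  by rewrite eq_sym -subr_eq0 opprK -mulr2n mulrn_eq0 => /eqP.
apply/ffunP => x; rewrite gE -/(t j) -/(V j).
case tj : (t j).
  rewrite css_op_Z ffunE; case: (boolP (_ <= _)%MS); rewrite ?mulr0 // memA.
  by move=> /forall_inP/(_ j tj)/eqP ->; rewrite expr0 mul1r.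
have VA : (V j <= A)%MS.
  have -> : V j = row j (H false) by rewrite rowK tj.
  by apply: submx_trans (row_sub _ _) _; apply/sub_kermxP.
rewrite css_op_X !ffunE vec_basisK; congr (_ * _%:R); congr nat_of_bool.
apply/idP/idP => [xVA|xA]; last exact: addmx_sub.
by rewrite -[basis_vec x](addrK (V j)) addmx_sub ?eqmx_opp.
Qed.

End States.

(** * Phase-free spiders as indicator functions *)

Lemma prodr_nat_of_bool (K : comPzSemiRingType) (I : finType) (P b : pred I) :
  \prod_(i | P i) (b i)%:R = [forall i, P i ==> b i]%:R :> K.
Proof.
have [/forall_inP h|] := boolP [forall i, P i ==> b i].
  by rewrite big1 // => i /h ->.
case/forallPn=> i; rewrite negb_imply => /andP[Pi bi].
by rewrite (bigD1 i) //= (negPf bi) mul0r.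
Qed.

Section Spiders.

Variable R : realType.
Implicit Type s : seq 'I_2.

Lemma expi0 : expi (0 : R) = 1.
Proof. by rewrite /expi cos0 sin0. Qed.

Lemma prod_delta_mx (a : 'I_2) s :
  \prod_(b <- s) (delta_mx a 0 : 'cV[R[i]%C]_2) b 0 = (all (pred1 a) s)%:R.
Proof.
elim: s => [|b s IHs]; rewrite ?big_nil // big_cons IHs mxE eqxx andbT /=.
by case: (b == a); rewrite ?mul1r ?mul0r.
Qed.

Lemma Z_spider0 (a : 'I_2) s :
  node_tensor ZNode (0 : R) (a :: s) = (all (pred1 a) s)%:R.
Proof.
rewrite /= /spider expi0 mul1r !prod_delta_mx /=.
by case: (F2P a) => -> /=; rewrite ?addr0 ?add0r.
Qed.

(** The minus vector differs from the plus vector by a sign on label 1, so the two products add up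
    to a multiple of 1 + (-1)^parity, which is 2 or 0. *)
Lemma X_spider0 s : node_tensor XNode (0 : R) s
  = 2 * (sqrtC 2)^-1 ^+ size s * (\sum_(b <- s) (b : 'F_2) == 0)%:R.
Proof.
rewrite /= /spider expi0 mul1r.
have plusE b : ketplus R b 0 = (sqrtC 2)^-1.
  by rewrite !mxE; case: (F2P b) => -> /=; rewrite ?addr0 ?add0r mulr1.
have minusE b : ketminus R b 0 = (sqrtC 2)^-1 * (-1) ^+ (b : 'F_2).
  rewrite !mxE; case: (F2P b) => -> /=; first by rewrite subr0.
  by rewrite sub0r.
under eq_bigr => b _ do rewrite plusE.
under [X in _ + X]eq_bigr => b _ do rewrite minusE.
rewrite big_split /= signr_F2_sum !big_const_seq !count_predT !iter_mulr_1.
by case: (F2P (\sum_(b <- s) (b : 'F_2))) => ->; rewrite /= ?expr0 ?expr1; ring.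
Qed.

End Spiders.

(** * Values of rule-abiding diagrams and their solution spaces *)

Definition is_X (k : zx_kind) : bool := if k is XNode then true else false.

Section Diagrams.

Variables (R : realType) (n : nat).
Local Notation C := R[i]%C.
Implicit Types (D : zx_diagram R n) (v : 'rV['F_2]_n) (y : qbasis n).

Lemma zx_edgeP D e : bipartite_rule D -> hadamard_rule D ->
  e \in zx_edges D ->
  exists i j, [/\ e = [set i; j], is_X (zx_node D i), ~~ is_X (zx_node D j)
                & (i < j)%N].
Proof.
move=> bipD hadD eD; have := zx_simple D.
move=> /forall_inP/(_ e eD)/cards2P[a [b [ab eE]]].
move: eD; rewrite eE => abD; have := bipD a b abD.
case aK: (zx_node D a); case bK: (zx_node D b) => // _.
  have [_ ba] : zx_node D a = ZNode /\ (b < a)%N.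
    by apply: hadD; rewrite // setUC.
  by exists b, a; rewrite aK bK setUC.
have [_ ltab] := hadD a b abD aK.
by exists a, b; rewrite aK bK.
Qed.

Definition zx_solution D v : bool :=
  [forall i, is_X (zx_node D i) ==>
     (v 0 i == \sum_(j | [set i; j] \in zx_edges D) v 0 j)].

Local Notation interior_edge D := {e : {set 'I_n} | e \in zx_edges D}.

(** Turns the sum over the interior legs of an X spider into a sum over neighbours: after exchanging
    the sums, a Z node [j] shares exactly one edge with [i] if they are adjacent and none
    otherwise. *)
Lemma sum_edge_Z D y i : bipartite_rule D -> hadamard_rule D ->
  is_X (zx_node D i) ->
  \sum_(e : interior_edge D | i \in sval e)
     \sum_(j in sval e | ~~ is_X (zx_node D j)) (y j : 'F_2)
  = \sum_(j | [set i; j] \in zx_edges D) (y j : 'F_2).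
Proof.
move=> bipD hadD iX.
rewrite (exchange_big_dep (fun j => ~~ is_X (zx_node D j))) /=; last first.
  by move=> e j _ /andP[].
rewrite [RHS](bigID (fun j => is_X (zx_node D j))) /= [X in _ = X + _]big1.
  rewrite add0r [RHS]big_mkcondl /=; apply: eq_bigr => j jZ.
  case: ifPn => ijD; last first.
    rewrite big_pred0 // => -[e eD] /=; rewrite jZ andbT.
    apply/negP => /andP[ie je]; case/negP: ijD; suff -> : [set i; j] = e by [].
    have ij : i != j by apply: contraNneq jZ => <-.
    apply/eqP; rewrite eqEcard subUset !sub1set ie je cards2 ij.
    by have /forall_inP/(_ e eD)/eqP -> := zx_simple D.
  rewrite (big_pred1 (Sub [set i; j] ijD)) // => -[e eD] /=.
  rewrite jZ andbT -val_eqE /=; apply/andP/eqP => [[ie je]|->].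
    have ij : i != j by apply: contraNneq jZ => <-.
    apply/esym/eqP; rewrite eqEcard subUset !sub1set ie je cards2 ij.
    by have /forall_inP/(_ e eD)/eqP -> := zx_simple D.
  by rewrite !inE !eqxx orbT.
move=> j /andP[ijD jX]; have := bipD i j ijD.
by move: iX jX; case: (zx_node D i) => //; case: (zx_node D j).
Qed.

Lemma zx_stateE D :
  bipartite_rule D -> hadamard_rule D -> phase_free_rule D ->
  exists2 c : C, c != 0 &
    zx_state D = [ffun y => c * (zx_solution D (basis_vec y))%:R].
Proof.
move=> bipD hadD pfD.
pose deg i := #|[pred e : interior_edge D | i \in sval e]|.
(* The scalar factors of the X spiders; the successor counts the free leg. *)
exists (\prod_(i | is_X (zx_node D i)) (2 * (sqrtC 2)^-1 ^+ (deg i).+1)).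
  apply/prodf_neq0 => i _.
  by rewrite mulf_neq0 ?expf_neq0 ?invr_neq0 ?sqrtC_eq0 ?pnatr_eq0.
rewrite /zx_state tensor_op1 => [|j]; last by have [_ ->] := pfD j.
apply/ffunP => y; rewrite !ffunE.
(* The Z spiders force every edge to carry the value of its Z end. *)
pose fy : {ffun interior_edge D -> 'I_2} :=
  [ffun e : interior_edge D =>
     \sum_(j in sval e | ~~ is_X (zx_node D j)) (y j : 'F_2)].
(* The sum defining [fy] has exactly one term, the Z end of the edge; this avoids choosing an
   endpoint. *)
have fyE (e : interior_edge D) j :
    j \in sval e -> ~~ is_X (zx_node D j) -> fy e = y j.
  rewrite ffunE; case: e => e eD /=.
  have [a [b [-> aX bZ _]]] := zx_edgeP bipD hadD eD.
  rewrite !inE => /orP[/eqP ->|/eqP -> _]; first by rewrite aX.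
  rewrite (big_pred1 b) // => k /=; rewrite !inE.
  apply/andP/eqP => [[/orP[/eqP->|/eqP//]]|->]; first by rewrite aX.
  by rewrite eqxx orbT.
(* If [f] differs from [fy] on an edge, the spider at the Z end of that edge has two unequal legs
   and vanishes. *)
rewrite (bigD1 fy) //= [X in _ + X]big1 ?addr0 => [|f ffy]; last first.
  have [e fe] : exists e, f e != fy e.
    apply/existsP; apply: contraNT ffy; rewrite negb_exists => /forallP h.
    by apply/eqP/ffunP => e; apply/eqP; rewrite -[_ == _]negbK.
  have [a [b [eE aX bZ _]]] := zx_edgeP bipD hadD (valP e).
  have be : b \in sval e by rewrite [sval e]eE !inE eqxx orbT.
  rewrite (bigD1 b) //=; have [-> _] := pfD b.
  move: (bZ); case bK : (zx_node D b) => // _.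
  rewrite Z_spider0 (_ : all _ _ = false) ?mul0r //.
  apply: contraNF fe => /allP/(_ (f e)) /=; rewrite (fyE e b) //.
  by apply; apply: image_f.
rewrite (bigID (fun i => is_X (zx_node D i))) /=.
rewrite [X in _ * X]big1 ?mulr1 => [|j jZ]; last first.
  have [-> _] := pfD j; move: (jZ); case jK : (zx_node D j) => // _.
  rewrite Z_spider0 (_ : all _ _ = true) //.
  by apply/allP => _ /imageP[e je ->] /=; rewrite (fyE e j).
rewrite /zx_solution -prodr_nat_of_bool -big_split /=.
apply: eq_bigr => i iX; have [-> _] := pfD i.
move: (iX); case iK : (zx_node D i) => // _; rewrite X_spider0.
rewrite /= size_map -cardE -/(deg i); congr (_ * _%:R); congr nat_of_bool.
rewrite big_cons big_image /= addr_eq0 oppr_F2 mxE.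
under [in RHS]eq_bigr => j _ do rewrite mxE.
rewrite -(sum_edge_Z y bipD hadD iX).
by congr (_ == _); apply: eq_bigr => e _; rewrite ffunE.
Qed.

(* The solution whose only nonzero free coordinate is j; its X coordinates
   list the neighbours of j. *)
Definition zx_basis_solution D (j : 'I_n) : 'rV['F_2]_n :=
  \row_k (if is_X (zx_node D k) then [set k; j] \in zx_edges D
          else k == j)%:R.

(** The neighbours of [i] in [D'] are Z nodes of both diagrams, where the basis solution of [D] is
    the unit vector at [j]; the sum thus tests adjacency to [j] in [D']. *)
Lemma sum_basis_solution D D' i j :
  bipartite_rule D' -> is_X (zx_node D' i) ->
  (forall k, is_X (zx_node D k) = is_X (zx_node D' k)) ->
  \sum_(k | [set i; k] \in zx_edges D') zx_basis_solution D j 0 k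
  = ([set i; j] \in zx_edges D')%:R.
Proof.
move=> bipD iX DX.
have kZ k : [set i; k] \in zx_edges D' -> is_X (zx_node D k) = false.
  move=> /bipD; rewrite DX; move: iX.
  by case: (zx_node D' i) => //; case: (zx_node D' k).
rewrite (eq_bigr (fun k => (k == j)%:R)) => [|k /kZ kX]; last first.
  by rewrite mxE kX.
case: (boolP (_ \in _)) => ijD.
  by rewrite (bigD1 j) //= eqxx big1 ?addr0 // => k /andP[_ /negPf ->].
by rewrite big1 // => k; case: eqVneq => // -> ijD'; rewrite ijD' in ijD.
Qed.

Lemma zx_basis_solutionP D j :
  bipartite_rule D -> zx_solution D (zx_basis_solution D j).
Proof.
move=> bipD; apply/forall_inP => i iX.
by rewrite sum_basis_solution // mxE iX.
Qed.

(** If [i] were Z in [D], its basis solution in [D] would be 1 at [i] and 0 at all higher positions,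
    since the X neighbours of [i] have lower numbers. The equation of [D'] at [i] involves only
    higher positions and would read 1 = 0. *)
Lemma zx_node_sub D D' i :
  bipartite_rule D -> hadamard_rule D -> hadamard_rule D' ->
  zx_solution D =1 zx_solution D' ->
  is_X (zx_node D' i) -> is_X (zx_node D i).
Proof.
move=> bipD hadD hadD' eqDD' iX'; apply/negPn/negP => iZ.
have := zx_basis_solutionP i bipD; rewrite eqDD' => /forall_inP/(_ i iX').
rewrite mxE (negPf iZ) eqxx big1 // => k ikD'.
have [|_ ik] := hadD' i k ikD'; first by case: (zx_node D' i) iX'.
rewrite mxE; case: ifP => kX; last by rewrite -val_eqE /= gtn_eqF.
case: (boolP (_ \in _)) => // kiD.
have [|_] := hadD k i kiD; first by case: (zx_node D k) kX.
by rewrite ltnNge ltnW.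
Qed.

(** For an edge of [D] with X end [i] and Z end [j], the basis solution at [j] is 1 at [i]; the
    equation of [D'] at [i] then forces the same edge in [D']. *)
Lemma zx_edges_sub D D' :
  bipartite_rule D -> hadamard_rule D -> bipartite_rule D' ->
  (forall k, is_X (zx_node D k) = is_X (zx_node D' k)) ->
  zx_solution D =1 zx_solution D' -> zx_edges D \subset zx_edges D'.
Proof.
move=> bipD hadD bipD' DX eqDD'; apply/subsetP => e eD.
have [i [j [eE iX _ _]]] := zx_edgeP bipD hadD eD; rewrite eE in eD *.
have := zx_basis_solutionP j bipD; rewrite eqDD' => /forall_inP/(_ i).
rewrite -DX => /(_ iX); rewrite sum_basis_solution -?DX // mxE iX eD.
by case: (_ \in _).
Qed.

Lemma zx_solution_inj D D' :
  [/\ bipartite_rule D, hadamard_rule D & phase_free_rule D] ->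
  [/\ bipartite_rule D', hadamard_rule D' & phase_free_rule D'] ->
  zx_solution D =1 zx_solution D' -> D = D'.
Proof.
move=> [bipD hadD pfD] [bipD' hadD' pfD'] eqDD'.
have eqD'D : zx_solution D' =1 zx_solution D by move=> v.
have DX k : is_X (zx_node D k) = is_X (zx_node D' k).
  by apply/idP/idP; apply: zx_node_sub.
have edgesE : zx_edges D = zx_edges D'.
  by apply/eqP; rewrite eqEsubset !zx_edges_sub.
have nodeE : zx_node D = zx_node D'.
  apply/ffunP => k; have := DX k.
  by case: (zx_node D k); case: (zx_node D' k).
have phaseE : zx_phase D = zx_phase D'.
  by apply/ffunP => k; have [-> _] := pfD k; have [-> _] := pfD' k.
have localE : zx_local D = zx_local D'.
  by apply/ffunP => k; have [_ ->] := pfD k; have [_ ->] := pfD' k.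
case: D D' edgesE nodeE phaseE localE
  {bipD hadD pfD bipD' hadD' pfD' eqDD' eqD'D DX}.
(* The simplicity proofs have equal types only once the edge sets are identified. *)
move=> N p E L s [N' p' E' L' s'] /= EE NN pp LL.
by case: _ / EE in s' *; case: _ / NN; case: _ / pp; case: _ / LL;
  rewrite (bool_irrelevance s s').
Qed.

(** Pivots become Z nodes, the other positions X nodes, and the nonzero non-pivot entries of the
    echelon basis become edges. *)
Lemma zx_solution_surj m (A : 'M['F_2]_(m, n)) : exists D,
  [/\ bipartite_rule D, hadamard_rule D, phase_free_rule D
    & forall v, zx_solution D v = (v <= A)%MS].
Proof.
have [B BA] := pivot_basis A.
pose E := [set e : {set 'I_n} | (#|e| == 2%N) &&
  [exists i in e, exists j in e,
     [&& ~~ pivot A i, pivot A j & B j 0 i != 0]]].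
have simpleE : [forall e in E, #|e| == 2%N].
  by apply/forall_inP => e; rewrite inE => /andP[].
have edgeE i j : ~~ pivot A i ->
    ([set i; j] \in E) = pivot A j && (B j 0 i != 0).
  move=> iX; rewrite inE; apply/andP/andP => [[_]|[jZ Bji]]; last first.
    have ij : i != j by apply: contraNneq iX => ->.
    rewrite cards2 ij; split=> //; apply/exists_inP; exists i.
      by rewrite !inE eqxx.
    by apply/exists_inP; exists j; rewrite ?iX ?jZ // !inE eqxx orbT.
  case/exists_inP=> a; rewrite !inE => ae /exists_inP[b]; rewrite !inE => be.
  case/and3P=> aX bZ Bba.
  have bj : b = j by case/orP: be => /eqP // bi; rewrite bi (negPf iX) in bZ.
  rewrite bj in bZ Bba *; case/orP: ae aX Bba => /eqP -> //.
  by rewrite bZ.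
pose D : zx_diagram R n := @ZXDiagram R n
  [ffun i => if pivot A i then ZNode else XNode] [ffun=> 0] E [ffun=> None]
  simpleE.
have DX i : is_X (zx_node D i) = ~~ pivot A i.
  by rewrite ffunE; case: ifP.
have edge_pivot i j : [set i; j] \in E -> pivot A i != pivot A j.
  move=> ijE; have [iZ|iX] := boolP (pivot A i); last first.
    by move: ijE; rewrite edgeE // => /andP[->].
  have [jZ|//] := boolP (pivot A j).
  move: ijE; rewrite inE => /andP[_ /exists_inP[a]]; rewrite !inE => ae.
  by case/exists_inP=> b _ /andP[]; case/orP: ae => /eqP ->; rewrite ?iZ ?jZ.
exists D; split.
- move=> i j /edge_pivot; rewrite !ffunE.
  by case: (pivot A i); case: (pivot A j).
- move=> i j ijE; rewrite !ffunE; case: ifPn => // iX _.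
  move: ijE; rewrite edgeE // => /andP[jZ Bji]; rewrite jZ; split=> //.
  (* The vector [B j] vanishes beyond its pivot [j], so its nonzero entry at [i] gives the order
     required by the Hadamard rule. *)
  have [_ _ Bj] := BA j jZ; rewrite ltn_neqAle leqNgt.
  apply/andP; split; first by apply: contraNneq iX => /val_inj ->.
  by apply: contraNN Bji => /Bj ->.
- by move=> i; rewrite !ffunE.
move=> v; rewrite (@sub_pivot_basis _ _ _ A B) => [|j jZ]; last first.
  by have [? ? _] := BA j jZ.
have sumE i : ~~ pivot A i ->
    \sum_(j | [set i; j] \in zx_edges D) v 0 j
    = (\sum_(j | pivot A j) v 0 j *: B j) 0 i.
  move=> iX; rewrite summxE big_mkcond [RHS]big_mkcond /=.
  apply: eq_bigr => j _; rewrite edgeE // F2_neq0 mxE.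
  case: (pivot A j) => //=.
  by case: (F2P (B j 0 i)) => ->; rewrite ?mulr0 ?mulr1.
apply/forall_inP/eqP => [vD|vE i]; last first.
  by rewrite DX => iX; rewrite sumE // -vE.
apply/rowP => i; have [iZ|iX] := boolP (pivot A i); last first.
  by rewrite -sumE //; apply/eqP/vD; rewrite DX.
rewrite summxE (bigD1 i) //= big1 => [|j /andP[jZ ji]].
  by have [_ Bi _] := BA i iZ; rewrite mxE Bi // eqxx mulr1 addr0.
by have [_ Bj _] := BA j jZ; rewrite mxE Bj // eq_sym (negPf ji) mulr0.
Qed.

(** The value of [D] is a nonzero multiple of the indicator function of its solutions, and two
    indicator functions that are proportional with a nonzero factor have the same support. *)
Lemma expressesP D (S : {group pauli_op n}) (A : 'M['F_2]_n) :
  bipartite_rule D -> hadamard_rule D -> phase_free_rule D ->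
  (forall psi : qstate R n, codespace S psi <->
     exists c : C, psi = [ffun x => c * (basis_vec x <= A)%MS%:R]) ->
  expresses D S <-> forall v, zx_solution D v = (v <= A)%MS.
Proof.
move=> bipD hadD pfD SA.
have [c c0 DE] := zx_stateE bipD hadD pfD.
split=> [[D0 SD] v|DA].
  have [|a aE] := (SA (zx_state D)).1.
    by apply/SD; exists 1; apply/ffunP => x; rewrite [in RHS]ffunE mul1r.
  have a0 : a != 0.
    apply: contra_neq D0 => a0; rewrite aE a0.
    by apply/ffunP => x; rewrite !ffunE mul0r.
  have /ffunP/(_ (vec_basis v)) := aE; rewrite DE !ffunE vec_basisK.
  case: (zx_solution D v); case: (v <= A)%MS => //; rewrite mulr1 mulr0 => /eqP.
    by rewrite (negPf c0).
  by rewrite eq_sym (negPf a0).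
have DAE : zx_state D = [ffun x => c * (basis_vec x <= A)%MS%:R].
  by rewrite DE; apply/ffunP => x; rewrite !ffunE DA.
split=> [|psi].
  apply: contra_neq c0 => /ffunP/(_ (vec_basis 0)).
  by rewrite DAE !ffunE vec_basisK sub0mx mulr1.
rewrite SA; split=> -[a ->]; [exists (a / c) | exists (a * c)];
  apply/ffunP => x; rewrite DAE !ffunE mulrA //.
by rewrite divfK.
Qed.

End Diagrams.

(** * Existence and uniqueness of the diagram of a CSS state *)

Theorem corollary3p4 (R : realType) (n : nat) (S : {group pauli_op n})
    (hS : CSS_state S) :
  exists! D : zx_diagram R n,
    [/\ bipartite_rule D, hadamard_rule D, phase_free_rule D & expresses D S].
Proof.
have [A SA] := CSS_state_codespace R hS.
have [D [bipD hadD pfD DA]] := zx_solution_surj R A.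
exists D; split; first by split=> //; apply/(expressesP bipD hadD pfD SA).
move=> D' [bipD' hadD' pfD' /(expressesP bipD' hadD' pfD' SA) DA'].
by apply: zx_solution_inj => // v; rewrite DA DA'.
Qed.
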